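(* Let $\Sigma_1,\Sigma_2$ be signed graphs (with markings) of order $m$ whose $\mu$-signed graphs $\Sigma_{1\mu},\Sigma_{2\mu}$ are not adjacency-cospectral, have equal energy, and have the same coronal, $\chi_{A(\Sigma_{1\mu})}(x)=\chi_{A(\Sigma_{2\mu})}(x)$. Then for every signed graph $\Sigma$ (with marking) of order $n$, the signed graphs $\Sigma\circledast\Sigma_1$ and $\Sigma\circledast\Sigma_2$ are not adjacency-cospectral and have equal energy.
   Context: A signed graph is a triple $\Sigma=(S,\sigma,\mu)$ where $S=(V,E)$ is a finite simple undirected graph, $\sigma:E\to\{+1,-1\}$ is a signature and $\mu:V\to\{+1,-1\}$ is a marking. Its adjacency matrix $A(\Sigma)$ has $(i,j)$ entry $\sigma(u_iu_j)$ if $u_i\sim u_j$ and $0$ otherwise. The energy of $\Sigma$ is the sum of the absolute values of the eigenvalues of $A(\Sigma)$; two signed graphs are cospectral if their adjacency matrices have the same spectrum. The $\mu$-signed graph of $\Sigma$ is $\Sigma_\mu=(S,\sigma_\mu,\mu)$ with $\sigma_\mu(uv)=\mu(u)\mu(v)$. With $\mu(\Sigma)\in\{\pm1\}^m$ the vector of marks, the coronal is the rational function $\chi_{A(\Sigma_\mu)}(x)=\mu(\Sigma)^T(xI_m-A(\Sigma_\mu))^{-1}\mu(\Sigma)$. Product $\Sigma\circledast\Sigma'$ of signed graphs $\Sigma$ (vertices $u_1,\dots,u_{n}$, marking $\mu$) and $\Sigma'$ (vertices $v_1,\dots,v_{m}$, marking $\mu'$): vertices $a_{ij},b_{ij}$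 ($1\le i\le n$, $1\le j\le m$) with marks $\mu(u_i)$ on $a_{ij}$ and $\mu'(v_j)$ on $b_{ij}$; edges $a_{ik}a_{jl}$ for all $1\le k,l\le m$ whenever $u_iu_j\in E(\Sigma)$, $b_{ri}b_{rj}$ for all $1\le r\le n$ whenever $v_iv_j\in E(\Sigma')$, and $a_{ip}b_{iq}$ for all $i$ and all $1\le p,q\le m$; every edge $xy$ gets sign equal to the product of the marks of $x$ and $y$. *)

(* Defs.v *)
From HB Require Import structures.
From mathcomp Require Import all_boot all_order all_algebra.
From mathcomp Require Import fraction.

Set Implicit Arguments.
Unset Strict Implicit.
Unset Printing Implicit Defensive.

Import Order.TTheory GRing.Theory Num.Theory.
Local Open Scope ring_scope.

Definition is_sign (s : int) : bool := (s == 1) || (s == -1).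

(* The signature is a total function on pairs of vertices, but only its values
   on adjacent pairs are constrained or ever used. *)
Record sgraph (V : finType) := SGraph {
  sg_adj : rel V;
  sg_sign : V -> V -> int;
  sg_mark : V -> int;
  sg_adj_sym : symmetric sg_adj;
  sg_adj_irr : irreflexive sg_adj;
  sg_sign_sym : forall u v, sg_adj u v -> sg_sign u v = sg_sign v u;
  sg_signP : forall u v, sg_adj u v -> is_sign (sg_sign u v);
  sg_markP : forall u, is_sign (sg_mark u)
}.

Lemma is_signM (s t : int) : is_sign s -> is_sign t -> is_sign (s * t).
Proof. by move=> /orP[]/eqP-> /orP[]/eqP->. Qed.

Section MarkSigned.
Variables (V : finType) (adj : rel V) (mark : V -> int).
Hypotheses (adj_sym : symmetric adj) (adj_irr : irreflexive adj).
Hypothesis markP : forall u, is_sign (mark u).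

Lemma mark_sign_sym u v : adj u v -> mark u * mark v = mark v * mark u.
Proof. by rewrite mulrC. Qed.

Lemma mark_signP u v : adj u v -> is_sign (mark u * mark v).
Proof. by move=> _; apply: is_signM. Qed.

Definition mark_sgraph : sgraph V :=
  SGraph adj_sym adj_irr mark_sign_sym mark_signP markP.
End MarkSigned.

Definition mu_sgraph (V : finType) (G : sgraph V) : sgraph V :=
  mark_sgraph (sg_adj_sym G) (sg_adj_irr G) (sg_markP G).

(* Vertices of the product: inl (u_i, v_j) is a_ij and inr (u_i, v_j) is b_ij. *)
Section Product.
Variables (V W : finType) (G : sgraph V) (H : sgraph W).

Definition prod_vertex : finType := (V * W + V * W)%type.

Definition prod_adj (x y : prod_vertex) : bool :=
  match x, y with
  | inl a, inl a' => sg_adj G a.1 a'.1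
  | inr b, inr b' => (b.1 == b'.1) && sg_adj H b.2 b'.2
  | inl a, inr b => a.1 == b.1
  | inr b, inl a => a.1 == b.1
  end.

Definition prod_mark (x : prod_vertex) : int :=
  match x with
  | inl a => sg_mark G a.1
  | inr b => sg_mark H b.2
  end.

Lemma prod_adj_sym : symmetric prod_adj.
Proof.
move=> [a|b] [a'|b'] //=; first exact: sg_adj_sym.
by rewrite eq_sym sg_adj_sym.
Qed.

Lemma prod_adj_irr : irreflexive prod_adj.
Proof. by move=> [a|b] /=; rewrite sg_adj_irr ?andbF. Qed.

Lemma prod_markP x : is_sign (prod_mark x).
Proof. by case: x => [a|b]; apply: sg_markP. Qed.

Definition sg_prod : sgraph prod_vertex :=
  mark_sgraph prod_adj_sym prod_adj_irr prod_markP.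
End Product.

Definition adjmx (R : pzRingType) (V : finType) (G : sgraph V) : 'M[R]_#|V| :=
  \matrix_(i, j)
    if sg_adj G (enum_val i) (enum_val j)
    then (sg_sign G (enum_val i) (enum_val j))%:~R else 0.

Definition markmx (R : pzRingType) (V : finType) (G : sgraph V) : 'cV[R]_#|V| :=
  \col_i (sg_mark G (enum_val i))%:~R.

(* The eigenvalues, listed with (algebraic) multiplicity, in some order. *)
Definition eigenvalues (C : closedFieldType) (n : nat) (A : 'M[C]_n) : seq C :=
  sval (closed_field_poly_normal (char_poly A)).

Definition cospectral (C : closedFieldType) (V W : finType)
    (G : sgraph V) (H : sgraph W) : bool :=
  perm_eq (eigenvalues (adjmx C G)) (eigenvalues (adjmx C H)).

Definition energy (C : numClosedFieldType) (V : finType) (G : sgraph V) : C :=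
  \sum_(z <- eigenvalues (adjmx C G)) `|z|.

(* mu^T (x I - A)^-1 mu, computed in the field of rational functions F(x). *)
Definition coronal (F : fieldType) (V : finType) (G : sgraph V) :
    {fraction {poly F}} :=
  let K : fieldType := {fraction {poly F}} in
  let x : K := tofrac ('X : {poly F}) in
  ((markmx K G)^T *m invmx (x%:M - adjmx K G) *m markmx K G) 0 0.

(* Main.v *)
Require Import Defs.
From HB Require Import structures.
From mathcomp Require Import all_boot all_order all_algebra.
From mathcomp Require Import fraction.
From mathcomp Require Import perm mxtens.

Set Implicit Arguments.
Unset Strict Implicit.
Unset Printing Implicit Defensive.

Import Order.TTheory GRing.Theory Num.Theory.
Local Open Scope ring_scope.

(** Up to a relabelling of the vertices, the adjacency matrix of the product of
    [G] and [H] is the block matrix with blocks [M *t J], [S *t 1 nu^T],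
    [S *t nu 1^T] and [I *t B], where [M] and [B] are the adjacency matrices of
    the mu-signed graphs of [G] and [H], [S] is the diagonal matrix of the marks
    of [G] (so [S^2 = I]), [nu] is the vector of marks of [H] and [J] is the
    all-ones matrix.  Taking the Schur complement of the last block, over the
    field of rational functions, gives

      [char_poly (G * H) = char_poly B ^ n * det (x I - (M + chi I) *t J)]

    where [chi] is the coronal.  The second factor only depends on [G], on the
    order of [H] and on [chi], so that [P1 * f2 ^ n = P2 * f1 ^ n] for the
    characteristic polynomials [Pi] of the two products and [fi] of the two
    mu-signed graphs.  Comparing roots with multiplicity, the spectrum of the
    first product together with [n] copies of that of [f2] is the spectrum of
    the second product together with [n] copies of that of [f1]. *)

Lemma det_castmx (R : comPzRingType) (p q : nat) (epq : p = q) (A : 'M[R]_p) :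
  \det (castmx (epq, epq) A) = \det A.
Proof. by case: q / epq; rewrite castmx_id. Qed.

Lemma det_mxsub_bij (R : comPzRingType) (p q : nat) (h : 'I_p -> 'I_q)
    (A : 'M[R]_q) :
  bijective h -> \det (mxsub h h A) = \det A.
Proof.
move=> h_bij; have := bij_eq_card h_bij; rewrite !card_ord => epq.
case: q / epq in h A h_bij *.
pose s := perm (bij_inj h_bij).
have -> : mxsub h h A = perm_mx s *m A *m perm_mx s^-1.
  rewrite -row_permE -col_permE.
  by apply/matrixP => i j; rewrite !mxE !permE.
by rewrite !det_mulmx mulrAC -det_mulmx -perm_mxM mulgV perm_mx1 det1 mul1r.
Qed.

Lemma det_scalar_sub_mxsub (R : comPzRingType) (p q : nat) (h : 'I_p -> 'I_q)
    (x : R) (A : 'M[R]_q) :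
  bijective h -> \det (x%:M - mxsub h h A) = \det (x%:M - A).
Proof.
move=> h_bij; rewrite -(det_mxsub_bij _ h_bij); congr (\det _).
by apply/matrixP => i j; rewrite !mxE (inj_eq (bij_inj h_bij)).
Qed.

Lemma det_block_schur (R : comUnitRingType) (p q : nat) (A : 'M[R]_p)
    (B : 'M[R]_(p, q)) (C : 'M[R]_(q, p)) (D : 'M[R]_q) :
  D \in unitmx ->
  \det (block_mx A B C D) = \det D * \det (A - B *m invmx D *m C).
Proof.
move=> D_unit.
pose L := block_mx 1%:M 0 (- (invmx D *m C)) 1%:M : 'M[R]_(p + q).
have det_L : \det L = 1 by rewrite det_lblock !det1 mulr1.
rewrite -[LHS]mulr1 -det_L -det_mulmx mulmx_block !mulmx0 !mulmx1 !add0r.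
by rewrite !mulmxN !mulmxA mulmxV // mul1mx subrr det_ublock mulrC.
Qed.

Section TensorLinearity.
Variables (R : pzRingType) (m n p q : nat).

Lemma tensmxDl (A B : 'M[R]_(m, n)) (C : 'M[R]_(p, q)) :
  (A + B) *t C = A *t C + B *t C.
Proof. by apply/matrixP => i j; rewrite !mxE mulrDl. Qed.

Lemma tensmxNl (A : 'M[R]_(m, n)) (B : 'M[R]_(p, q)) :
  (- A) *t B = - (A *t B).
Proof. by apply/matrixP => i j; rewrite !mxE mulNr. Qed.

Lemma tensmxBr (A : 'M[R]_(m, n)) (B C : 'M[R]_(p, q)) :
  A *t (B - C) = A *t B - A *t C.
Proof. by apply/matrixP => i j; rewrite !mxE mulrBr. Qed.

End TensorLinearity.

Lemma tensmx_scalar (R : pzRingType) (n m : nat) (a b : R) :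
  (a%:M : 'M_n) *t (b%:M : 'M_m) = (a * b)%:M.
Proof.
apply/matrixP => i j.
case: (mxtens_indexP i) => i1 i2; case: (mxtens_indexP j) => j1 j2.
rewrite tensmxE !mxE (can_eq (@mxtens_indexK _ _)) xpair_eqE.
by rewrite mulrnAl mulrnAr -mulrnA mulnb andbC.
Qed.

Lemma det_tens1mx (R : comPzRingType) (n m : nat) (B : 'M[R]_m) :
  \det ((1%:M : 'M_n) *t B) = \det B ^+ n.
Proof.
elim: n => [|n IHn]; first by rewrite det_mx00.
rewrite -[n.+1]/(1 + n)%N (scalar_mx_block 1 n) tens_block_mx.
rewrite det_castmx !tens0mx det_ublock IHn exprS.
by rewrite -[_%:M]/(1 : 'M_1) tens_scalar1mx det_castmx.
Qed.

Section TensorIdentity.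
Variables (R : comUnitRingType) (n m : nat) (D : 'M[R]_m).
Hypothesis D_unit : D \in unitmx.

Lemma tens1mx_unit : (1%:M : 'M_n) *t D \in unitmx.
Proof. by rewrite unitmxE det_tens1mx unitrX. Qed.

Lemma invmx_tens1mx : invmx ((1%:M : 'M_n) *t D) = 1%:M *t invmx D.
Proof.
apply: (can_inj (mulKmx tens1mx_unit)).
rewrite mulmxV ?tens1mx_unit // tensmx_mul mul1mx mulmxV //.
by rewrite tensmx_scalar mulr1.
Qed.

Lemma det_block_schur_tens (p : nat) (A : 'M[R]_(n * p)) (S T : 'M[R]_n)
    (B : 'M[R]_(p, m)) (C : 'M[R]_(m, p)) :
  \det (block_mx A (S *t B) (T *t C) (1%:M *t D)) =
  \det D ^+ n * \det (A - (S *m T) *t (B *m invmx D *m C)).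
Proof.
rewrite det_block_schur ?tens1mx_unit // det_tens1mx invmx_tens1mx.
by rewrite !tensmx_mul mulmx1.
Qed.

End TensorIdentity.

Lemma mul_const_mx11 (R : pzRingType) (p q : nat) (a b : R) (A : 'M[R]_1) :
  (const_mx a : 'cV_p) *m A *m (const_mx b : 'rV_q) = const_mx (a * A 0 0 * b).
Proof. by apply/matrixP => i j; rewrite !(mxE, big_ord1). Qed.

Definition mx_coronal (R : comUnitRingType) (m : nat) (x : R) (B : 'M[R]_m)
    (u : 'cV[R]_m) : R :=
  (u^T *m invmx (x%:M - B) *m u) 0 0.

Definition coronal_factor (R : comPzRingType) (n m : nat) (x chi : R)
    (A : 'M[R]_n) : R :=
  \det (x%:M - (A + chi%:M) *t (const_mx 1 : 'M_m)).

Lemma det_coronal_block (R : comUnitRingType) (n m p : nat) (x : R)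
    (A S : 'M[R]_n) (B : 'M[R]_m) (u : 'cV[R]_m) :
  S *m S = 1%:M -> x%:M - B \in unitmx ->
  \det (x%:M - block_mx (A *t (const_mx 1 : 'M_p))
                        (S *t ((const_mx 1 : 'cV_p) *m u^T))
                        (S *t (u *m (const_mx 1 : 'rV_p)))
                        (1%:M *t B)) =
  \det (x%:M - B) ^+ n * coronal_factor p x (mx_coronal x B u) A.
Proof.
move=> S_sqr xB_unit.
rewrite scalar_mx_block opp_block_mx add_block_mx !add0r.
have -> : x%:M - 1%:M *t B = (1%:M : 'M_n) *t (x%:M - B).
  by rewrite tensmxBr tensmx_scalar mul1r.
rewrite -!tensmxNl det_block_schur_tens // mulNmx mulmxN opprK S_sqr.
congr (_ * \det _).
have -> : const_mx 1 *m u^T *m invmx (x%:M - B) *m (u *m const_mx 1) =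
    const_mx (mx_coronal x B u) :> 'M_p.
  rewrite mulmxA -[_ *m u^T *m _]mulmxA -[_ *m u]mulmxA.
  by rewrite mul_const_mx11 mul1r mulr1.
rewrite tensmxNl -addrA -opprD tensmxDl; congr (_ - (_ + _)).
by apply/matrixP => i j; rewrite !mxE mulr1 mulr_natl.
Qed.

Section AdjacencyOfProduct.
Variables (V W : finType) (G : sgraph V) (H : sgraph W).

Definition pair_index (a : V * W) : 'I_(#|V| * #|W|) :=
  mxtens_index (enum_rank a.1, enum_rank a.2).

Lemma pair_index_inj : injective pair_index.
Proof.
move=> [u v] [u' v'] /(can_inj (@mxtens_indexK _ _)) [].
by move=> /enum_rank_inj-> /enum_rank_inj->.
Qed.

Definition prod_vertex_index (x : prod_vertex V W) :
    'I_(#|V| * #|W| + #|V| * #|W|) :=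
  match x with
  | inl a => lshift _ (pair_index a)
  | inr b => rshift _ (pair_index b)
  end.

Lemma prod_vertex_index_inj : injective prod_vertex_index.
Proof.
case=> [a|b] [a'|b'] /= /eqP; rewrite ?eq_lrshift ?eq_rlshift //.
  by rewrite eq_lshift => /eqP/pair_index_inj->.
by rewrite eq_rshift => /eqP/pair_index_inj->.
Qed.

Definition prod_block_index (i : 'I_#|prod_vertex V W|) :
    'I_(#|V| * #|W| + #|V| * #|W|) :=
  prod_vertex_index (enum_val i).

Lemma prod_block_index_bij : bijective prod_block_index.
Proof.
apply: inj_card_bij; last by rewrite !card_ord card_sum card_prod.
exact: inj_comp prod_vertex_index_inj enum_val_inj.
Qed.

Definition mark_diag_mx (R : pzRingType) : 'M[R]_#|V| :=
  diag_mx (markmx R G)^T.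

Lemma mark_diag_mx_sqr (R : pzRingType) :
  mark_diag_mx R *m mark_diag_mx R = 1%:M.
Proof.
rewrite mulmx_diag; apply/matrixP => i j; rewrite !mxE -intrM.
by case/orP: (sg_markP G (enum_val i)) => /eqP->.
Qed.

Lemma mark_diag_mxE (R : pzRingType) (u v : V) :
  mark_diag_mx R (enum_rank u) (enum_rank v) = (sg_mark G u)%:~R *+ (u == v).
Proof. by rewrite !mxE enum_rankK (inj_eq enum_rank_inj). Qed.

Lemma adjmx_sg_prod (R : comPzRingType) :
  adjmx R (sg_prod G H) =
  mxsub prod_block_index prod_block_index
    (block_mx (adjmx R (mu_sgraph G) *t (const_mx 1 : 'M_#|W|))
              (mark_diag_mx R *t ((const_mx 1 : 'cV_#|W|) *m (markmx R H)^T))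
              (mark_diag_mx R *t (markmx R H *m (const_mx 1 : 'rV_#|W|)))
              (1%:M *t adjmx R (mu_sgraph H))).
Proof.
apply/matrixP => i j; rewrite [LHS]mxE [RHS]mxE /prod_block_index.
case: (enum_val i) (enum_val j) => [[u v]|[u v]] [[u' v']|[u' v']] /=.
- by rewrite block_mxEul tensmxE !mxE !enum_rankK mulr1.
- rewrite block_mxEur tensmxE mark_diag_mxE !mxE big_ord1 !mxE enum_rankK mul1r.
  by case: eqP => _; rewrite ?mul0r // mulr1n intrM.
- rewrite block_mxEdl tensmxE mark_diag_mxE !mxE big_ord1 !mxE enum_rankK mulr1.
  by rewrite eq_sym; case: eqP => [->|_]; rewrite ?mul0r // mulr1n intrM mulrC.
- rewrite block_mxEdr tensmxE !mxE !enum_rankK (inj_eq enum_rank_inj).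
  by case: eqP => _; rewrite ?mul0r ?mul1r.
Qed.

Lemma det_sg_prod (R : comUnitRingType) (x : R) :
  x%:M - adjmx R (mu_sgraph H) \in unitmx ->
  \det (x%:M - adjmx R (sg_prod G H)) =
  \det (x%:M - adjmx R (mu_sgraph H)) ^+ #|V| *
  coronal_factor #|W| x (mx_coronal x (adjmx R (mu_sgraph H)) (markmx R H))
    (adjmx R (mu_sgraph G)).
Proof.
move=> xH_unit; rewrite adjmx_sg_prod.
rewrite (det_scalar_sub_mxsub _ _ prod_block_index_bij).
by rewrite det_coronal_block // mark_diag_mx_sqr.
Qed.

End AdjacencyOfProduct.

Lemma map_adjmx (R S : pzRingType) (f : {rmorphism R -> S}) (V : finType)
    (G : sgraph V) :
  map_mx f (adjmx R G) = adjmx S G.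
Proof.
by apply/matrixP => i j; rewrite !mxE; case: ifP; rewrite ?rmorph_int ?rmorph0.
Qed.

Lemma tofrac_char_poly (F : fieldType) (V : finType) (G : sgraph V) :
  tofrac (char_poly (adjmx F G)) =
  \det ((tofrac 'X)%:M - adjmx {fraction {poly F}} G).
Proof.
rewrite -det_map_mx map_mxB map_scalar_mx.
by rewrite -map_mx_comp /= (map_adjmx (@tofrac {poly F} \o polyC)).
Qed.

Lemma coronalE (F : fieldType) (V : finType) (G : sgraph V) :
  let K : fieldType := {fraction {poly F}} in
  coronal F G = mx_coronal (tofrac 'X : K) (adjmx K G) (markmx K G).
Proof. by []. Qed.

Lemma char_poly_sg_prod (F : fieldType) (V W : finType) (G : sgraph V)
    (H : sgraph W) :
  tofrac (char_poly (adjmx F (sg_prod G H))) =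
  tofrac (char_poly (adjmx F (mu_sgraph H))) ^+ #|V| *
  coronal_factor #|W| (tofrac 'X) (coronal F (mu_sgraph H))
    (adjmx {fraction {poly F}} (mu_sgraph G)).
Proof.
rewrite !tofrac_char_poly coronalE det_sg_prod //.
rewrite unitmxE -tofrac_char_poly unitfE tofrac_eq0.
by rewrite monic_neq0 ?char_poly_monic.
Qed.

Lemma char_poly_sg_prod_cross (F : fieldType) (V V1 V2 : finType)
    (G : sgraph V) (G1 : sgraph V1) (G2 : sgraph V2) :
  #|V1| = #|V2| -> coronal F (mu_sgraph G1) = coronal F (mu_sgraph G2) ->
  char_poly (adjmx F (sg_prod G G1)) *
    char_poly (adjmx F (mu_sgraph G2)) ^+ #|V| =
  char_poly (adjmx F (sg_prod G G2)) *
    char_poly (adjmx F (mu_sgraph G1)) ^+ #|V|.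
Proof.
move=> eq_order eq_coronal; apply/eqP; rewrite -tofrac_eq !rmorphM !rmorphXn /=.
rewrite !char_poly_sg_prod eq_coronal.
rewrite (congr1 (fun m => coronal_factor m _ _ _) eq_order).
by rewrite mulrAC [eqbRHS]mulrAC [X in X * _]mulrC.
Qed.

Lemma prod_eigenvalues (C : closedFieldType) (n : nat) (A : 'M[C]_n) :
  \prod_(z <- eigenvalues A) ('X - z%:P) = char_poly A.
Proof.
rewrite /eigenvalues; case: closed_field_poly_normal => s /=.
by rewrite (monicP (char_poly_monic A)) scale1r.
Qed.

Lemma perm_flatten_nseq (T : eqType) (k : nat) (s t : seq T) :
  (0 < k)%N -> perm_eq (flatten (nseq k s)) (flatten (nseq k t)) = perm_eq s t.
Proof.
move=> k_gt0.
have count_copies u a : count a (flatten (nseq k u)) = (k * count a u)%N.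
  by rewrite count_flatten map_nseq sumn_nseq mulnC.
apply/idP/idP => /seq.permP st; apply/seq.permP => a;
  last by rewrite !count_copies st.
by apply/eqP; rewrite -(eqn_pmul2l k_gt0) -!count_copies st.
Qed.

Lemma perm_cat_flatten_nseq (T : eqType) (k : nat) (s1 s2 t1 t2 : seq T) :
  (0 < k)%N ->
  perm_eq (s1 ++ flatten (nseq k t2)) (s2 ++ flatten (nseq k t1)) ->
  perm_eq s1 s2 = perm_eq t1 t2.
Proof.
move=> k_gt0 eq_st; rewrite -(perm_flatten_nseq t1 t2 k_gt0).
rewrite -(perm_cat2r (flatten (nseq k t2))) (permPl eq_st).
exact: perm_cat2l.
Qed.

Lemma sum_cat_flatten_nseq (U : nmodType) (T : Type) (k : nat) (s t : seq T)
    (f : T -> U) :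
  \sum_(z <- s ++ flatten (nseq k t)) f z =
  \sum_(z <- s) f z + (\sum_(z <- t) f z) *+ k.
Proof. by rewrite big_cat big_flatten big_nseq iter_addr_0. Qed.

Section ProductSpectrum.
Variables (V V1 V2 : finType).
Variables (G : sgraph V) (G1 : sgraph V1) (G2 : sgraph V2).
Hypothesis eq_order : #|V1| = #|V2|.

Lemma perm_eigenvalues_sg_prod (C : closedFieldType) :
  coronal C (mu_sgraph G1) = coronal C (mu_sgraph G2) ->
  perm_eq
    (eigenvalues (adjmx C (sg_prod G G1)) ++
       flatten (nseq #|V| (eigenvalues (adjmx C (mu_sgraph G2)))))
    (eigenvalues (adjmx C (sg_prod G G2)) ++
       flatten (nseq #|V| (eigenvalues (adjmx C (mu_sgraph G1))))).
Proof.
move=> eq_coronal; apply: prod_XsubC_eq.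
rewrite !big_cat /= !big_flatten !big_nseq !iter_mulr_1 !prod_eigenvalues.
exact: char_poly_sg_prod_cross.
Qed.

Lemma cospectral_sg_prod (C : closedFieldType) :
  (0 < #|V|)%N -> coronal C (mu_sgraph G1) = coronal C (mu_sgraph G2) ->
  cospectral C (sg_prod G G1) (sg_prod G G2) =
  cospectral C (mu_sgraph G1) (mu_sgraph G2).
Proof.
move=> V_gt0 eq_coronal.
exact: perm_cat_flatten_nseq V_gt0 (perm_eigenvalues_sg_prod eq_coronal).
Qed.

Lemma energy_sg_prod (C : numClosedFieldType) :
  coronal C (mu_sgraph G1) = coronal C (mu_sgraph G2) ->
  energy C (sg_prod G G1) + energy C (mu_sgraph G2) *+ #|V| =
  energy C (sg_prod G G2) + energy C (mu_sgraph G1) *+ #|V|.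
Proof.
move=> eq_coronal; rewrite /energy -!sum_cat_flatten_nseq.
exact: perm_big (perm_eigenvalues_sg_prod eq_coronal).
Qed.

End ProductSpectrum.

Theorem theorem8 (C : numClosedFieldType) (m : nat) (V1 V2 : finType)
    (Sigma1 : sgraph V1) (Sigma2 : sgraph V2)
    (order1 : #|V1| = m) (order2 : #|V2| = m)
    (noncospectral : ~ cospectral C (mu_sgraph Sigma1) (mu_sgraph Sigma2))
    (equienergetic : energy C (mu_sgraph Sigma1) = energy C (mu_sgraph Sigma2))
    (same_coronal : coronal C (mu_sgraph Sigma1) = coronal C (mu_sgraph Sigma2))
    (n : nat) (V : finType) (Sigma : sgraph V)
    (n_gt0 : (0 < n)%N) (order : #|V| = n) :
  ~ cospectral C (sg_prod Sigma Sigma1) (sg_prod Sigma Sigma2) /\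
  energy C (sg_prod Sigma Sigma1) = energy C (sg_prod Sigma Sigma2).
Proof.
have eq_order : #|V1| = #|V2| by rewrite order1 order2.
split; first by rewrite cospectral_sg_prod ?order.
have := energy_sg_prod Sigma eq_order same_coronal.
by rewrite equienergetic => /addIr.
Qed.
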